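(* Let $\Phi \subseteq 2^E$ be an interval and let $e \in E$ be a vertex of $\Phi$. If $\Phi$ satisfies the spectral recursion with respect to $e$, then for all integers $i, j$ the skeleton $\Phi^{(i,j)} = \{F \in \Phi : i \leq \dim F \leq j\}$ satisfies the spectral recursion with respect to $e$.
   Context: $E$ is a finite set and $2^E$ its Boolean algebra of subsets. A set $\Phi \subseteq 2^E$ is an interval if $F \subseteq G \subseteq H$ and $F,H \in \Phi$ imply $G \in \Phi$. Elements of the ground set $E$ are the vertices of $\Phi$ (a vertex need not lie in any face); members of $\Phi$ are its faces; $\dim F = |F|-1$. $\Phi_i$ is the set of $i$-dimensional faces, $i \ge -1$. For $e \in E$: the deletion is $\Phi - e = \{F \in \Phi : e \notin F\}$, the contraction is $\Phi/e = \{F \setminus \{e\} : F \in \Phi,\ e \in F\}$, the star is $\mathrm{st}_\Phi e = \bigcup \{F, F \cup \{e\}\}$ over all $F$ with $e \notin F$ and $F, F\cup\{e\} \in \Phi$, and the reduction is $\Phi \| e = \Phi \setminus \mathrm{st}_\Phi e$. Each of $\Phi-e$, $\Phi/e$, $\Phi\|e$ is again an interval in $2^E$. Fix a total order on $E$. $C_i(\Phi;\mathbb{R})$ is the real vector space with basis $\Phi_i$; the boundary operator $\partial_i : C_i \to C_{i-1}$ sends $F = \{v_0 < \cdots < v_i\}$ to $\sum_j (-1)^j (F \setminus \{v_j\})$, the sum over those $j$ with $F\setminus\{v_j\} \in \Phi$. Let $\partial_i^*$ be its adjoint (transpose in these bases). The Laplacian is $L_i(\Phi) = \partial_{i+1}\partial_{i+1}^*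 + \partial_i^*\partial_i$ on $C_i(\Phi;\mathbb{R})$; its eigenvalues are non-negative reals and do not depend on the vertex order. $\mathbf{s}_i(\Phi)$ is the multiset of eigenvalues of $L_i(\Phi)$. The spectrum polynomial is the formal generating function $S_\Phi(t,q) = \sum_{i \ge 0} t^i \sum_{\lambda \in \mathbf{s}_{i-1}(\Phi)} q^\lambda$ (formal sums of $q^\lambda$ with real exponents $\lambda \ge 0$). $\Phi$ satisfies the spectral recursion with respect to $e$ if $e$ is a vertex of $\Phi$ and $S_\Phi(t,q) = q\,S_{\Phi-e}(t,q) + qt\,S_{\Phi/e}(t,q) + (1-q)\,S_{\Phi\|e}(t,q)$. *)

(* Defs.v *)
From HB Require Import structures.
From mathcomp Require Import all_boot all_order all_algebra.
From mathcomp Require Import polyrcf.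
From mathcomp Require Import monalg.

Set Implicit Arguments.
Unset Strict Implicit.
Unset Printing Implicit Defensive.

Import Order.TTheory GRing.Theory Num.Theory.
Local Open Scope ring_scope.

Section Intervals.
Variable E : finType.
Implicit Types (Phi : {set {set E}}) (e : E) (F G H : {set E}).

Definition is_interval Phi : Prop :=
  forall F G H, F \subset G -> G \subset H ->
    F \in Phi -> H \in Phi -> G \in Phi.

Definition deletion Phi e : {set {set E}} := [set F in Phi | e \notin F].

Definition contraction Phi e : {set {set E}} :=
  [set F :\ e | F in Phi & e \in F].

Definition star Phi e : {set {set E}} :=
  \bigcup_(F : {set E} | [&& e \notin F, F \in Phi & e |: F \in Phi])
    [set F; e |: F].

Definition reduction Phi e : {set {set E}} := Phi :\: star Phi e.

Definition dim F : int := #|F|%:Z - 1.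

Definition faces Phi (i : int) : {set {set E}} := [set F in Phi | dim F == i].

Definition skeleton Phi (i j : int) : {set {set E}} :=
  [set F in Phi | i <= dim F <= j].

End Intervals.

Section Laplacian.
Variables (R : rcfType) (d : Order.disp_t) (E : finOrderType d).
Implicit Types (Phi : {set {set E}}) (F G : {set E}).

(* If F = {v_0 < ... < v_i} and v = v_j, then j is the number of vertices of F
   smaller than v. *)
Definition incidence F G : R :=
  \sum_(v in F | F :\ v == G) (-1) ^+ #|[set w in F | (w < v)%O]|.

(* The matrix, acting on column vectors, of the boundary operator from C_i to
   C_k in the bases of faces; it is only meaningful for k = i - 1, but keeping
   k separate lets the Laplacian typecheck without casts along i + 1 - 1 = i. *)
Definition boundary Phi (i k : int) : 'M[R]_(#|faces Phi k|, #|faces Phi i|) :=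
  \matrix_(b, a) incidence (enum_val a) (enum_val b).

Definition laplacian Phi (i : int) : 'M[R]_#|faces Phi i| :=
  boundary Phi (i + 1) i *m (boundary Phi (i + 1) i)^T
  + (boundary Phi i (i - 1))^T *m boundary Phi i (i - 1).

(* The eigenvalues repeated according to their algebraic multiplicity, i.e. the
   multiset s_i(Phi); only sums over this list are used, so its order does not
   matter. *)
Definition spectrum Phi (i : int) : seq R :=
  let p := char_poly (laplacian Phi i) in
  flatten [seq nseq (mup x p) x | x <- rootsR p].

End Laplacian.

Section Exponents.
Variable R : rcfType.

Record exponent : predArgType :=
  Exponent { exponent_val :> R; exponent_ge0 : 0 <= exponent_val }.

HB.instance Definition _ := [isSub for exponent_val].
HB.instance Definition _ := [Choice of exponent by <:].

Implicit Types x y : exponent.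

Definition exponent0 : exponent := Exponent (lexx 0).
Definition exponentD x y : exponent :=
  Exponent (addr_ge0 (exponent_ge0 x) (exponent_ge0 y)).

Lemma exponentDA : associative exponentD.
Proof. by move=> x y z; apply/val_inj; rewrite /= addrA. Qed.

Lemma exponentDC : commutative exponentD.
Proof. by move=> x y; apply/val_inj; rewrite /= addrC. Qed.

Lemma exponent0D : left_id exponent0 exponentD.
Proof. by move=> x; apply/val_inj; rewrite /= add0r. Qed.

Lemma exponentD0 : right_id exponent0 exponentD.
Proof. by move=> x; apply/val_inj; rewrite /= addr0. Qed.

Lemma exponentD_eq0 x y :
  exponentD x y = exponent0 -> x = exponent0 /\ y = exponent0.
Proof.
move=> /(congr1 val)/= /eqP; rewrite paddr_eq0 ?exponent_ge0 //.
by case/andP=> /eqP x0 /eqP y0; split; apply/val_inj.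
Qed.

HB.instance Definition _ := Choice_isMonomialDef.Build exponent
  exponentDA exponent0D exponentD0 exponentD_eq0.
HB.instance Definition _ := MonomialDef_isConomialDef.Build exponent exponentDC.

(* Formal sums of powers q^x with integer coefficients and real exponents
   x >= 0, and polynomials in t = 'X over them. *)
Definition qring := {malg int[exponent]}.
HB.instance Definition _ := GRing.ComRing.on qring.

(* insubd sends a negative x to exponent 0, but this case does not arise: see
   spectrum_ge0. *)
Definition qpow (x : R) : qring := << insubd exponent0 x >>.

Definition q : {poly qring} := (qpow 1)%:P.
Definition t : {poly qring} := 'X.

End Exponents.

Arguments q {R}.
Arguments t {R}.

Section SpectralRecursion.
Variables (R : rcfType) (d : Order.disp_t) (E : finOrderType d).
Implicit Types Phi : {set {set E}}.

Lemma spectrum_ge0 Phi (i : int) (x : R) : x \in spectrum R Phi i -> 0 <= x.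
Proof.
set L := laplacian R Phi i; set p := char_poly L.
case/flattenP=> s /mapP[y y_root ->]; rewrite mem_nseq => /andP[_ /eqP->] {x s}.
have p_neq0 : p != 0 by rewrite monic_neq0 ?char_poly_monic.
have {y_root} : root p y.
  by move: (roots_on_rootsR p_neq0 y); rewrite y_root inE /=.
rewrite -eigenvalue_root_char => /eigenvalueP[v vL v_neq0].
pose n2 m (u : 'rV[R]_m) := (u *m u^T) 0 0.
have n2E m (u : 'rV[R]_m) : n2 m u = \sum_j u 0 j ^+ 2.
  by rewrite /n2 mxE; apply: eq_bigr => j _; rewrite mxE.
have n2_ge0 m (u : 'rV[R]_m) : 0 <= n2 m u.
  by rewrite n2E sumr_ge0 // => j _; rewrite sqr_ge0.
have n2v_gt0 : 0 < n2 _ v.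
  rewrite lt0r n2_ge0 andbT; apply: contraNneq v_neq0 => /eqP.
  rewrite n2E psumr_eq0 => [/allP v0|j _]; last exact: sqr_ge0.
  apply/eqP/rowP=> j; rewrite mxE; apply/eqP.
  by move: (v0 j (mem_index_enum j)); rewrite sqrf_eq0.
have : y * n2 _ v = (v *m L *m v^T) 0 0 by rewrite vL -scalemxAl [RHS]mxE.
rewrite /L /laplacian mulmxDr mulmxDl mxE => yv.
rewrite -(pmulr_lge0 _ n2v_gt0) yv.
set A := boundary R Phi (i + 1) i; set B := boundary R Phi i (i - 1).
have -> : v *m (A *m A^T) *m v^T = (v *m A) *m (v *m A)^T.
  by rewrite trmx_mul !mulmxA.
have -> : v *m (B^T *m B) *m v^T = (v *m B^T) *m (v *m B^T)^T.
  by rewrite trmx_mul trmxK !mulmxA.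
exact: addr_ge0 (n2_ge0 _ _) (n2_ge0 _ _).
Qed.

(* The coefficient of t^i vanishes for i > #|E|. *)
Definition spectrum_poly Phi : {poly qring R} :=
  \sum_(i < #|E|.+1)
    t ^+ i * (\sum_(x <- spectrum R Phi (i%:Z - 1)) qpow x)%:P.

Definition satisfies_spectral_recursion Phi (e : E) : Prop :=
  spectrum_poly Phi =
      q * spectrum_poly (deletion Phi e)
    + q * t * spectrum_poly (contraction Phi e)
    + (1 - q) * spectrum_poly (reduction Phi e).

End SpectralRecursion.

(* Main.v *)
Require Import Defs.
From mathcomp Require Import all_boot all_order all_algebra.
From mathcomp Require Import reals polyrcf monalg.
From mathcomp Require Import zify ring.

(* Write N_k for the sum of q^x - 1 over the eigenvalues x of d_k d_k^*, where
   d_k is the boundary of C_k. In an interval d_k d_{k+1} = 0, so the nonzero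
   spectrum of L_k is the union of those of d_k d_k^* and d_{k+1} d_{k+1}^*, and
   the coefficient of t^{k+1} in the spectrum polynomial is f_k + N_k + N_{k+1},
   with f_k the number of k-faces. Hence the defect in the spectral recursion at
   degree k + 1 has the form X_k + X_{k+1}, where X_k combines the N_k of Phi and
   of its three minors with the number of pairs {F, F + e} in Phi, dim F = k - 1.
   As X_k = 0 for k < 0, the recursion holds iff all X_k vanish. In the skeleton
   X_k is unchanged for i < k <= j, because the faces gained by the reduction are
   isolated in the extreme dimensions, and is 0 for all other k. *)

Set Implicit Arguments.
Unset Strict Implicit.
Unset Printing Implicit Defensive.

Import Order.TTheory GRing.Theory Num.Theory.
Local Open Scope ring_scope.

Local Notation dim := Defs.dim.

(** * Characteristic polynomials of products and sums of matrices *)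

(** Both sides are $\det M \cdot X^n$ for the block matrix [M]: clearing its lower left block by
    column operations produces [A *m B], by row operations [B *m A]. *)
Lemma char_poly_mulmxC (R : comNzRingType) m n (A : 'M[R]_(m, n))
    (B : 'M[R]_(n, m)) :
  char_poly (A *m B) * 'X^n = char_poly (B *m A) * 'X^m.
Proof.
set A' := map_mx polyC A; set B' := map_mx polyC B.
pose M := block_mx 'X%:M A' B' 1%:M.
have AB : \det M = char_poly (A *m B).
  have -> : \det M = \det (M *m block_mx 1%:M 0 (- B') 1%:M).
    by rewrite det_mulmx det_lblock !det1 !mulr1.
  rewrite mulmx_block !mulmx1 !mulmx0 !add0r mul1mx subrr det_ublock det1 mulr1.
  by rewrite mulmxN /char_poly /char_poly_mx map_mxM.
rewrite -AB; have -> : \det M * 'X^n = \det (block_mx 1%:M 0 (- B') 'X%:M *m M).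
  by rewrite det_mulmx det_lblock det1 mul1r det_scalar mulrC.
rewrite mulmx_block !mul1mx !mul0mx !addr0 mulmx1 mulNmx.
rewrite scalar_mxC addNr det_ublock det_scalar mulrC -map_mxN.
by rewrite /char_poly /char_poly_mx map_mxM map_mxN mulNmx addrC mulrC.
Qed.

(** If $AB = 0$ then $(X - A)(X - B) = X (X - (A + B))$; take determinants. *)
Lemma char_polyD_mul0 (R : comNzRingType) n (A B : 'M[R]_n) :
  A *m B = 0 -> char_poly (A + B) * 'X^n = char_poly A * char_poly B.
Proof.
move=> AB0; rewrite /char_poly -det_mulmx -(det_scalar n 'X) -det_mulmx.
congr (\det _); rewrite /char_poly_mx map_mxD.
rewrite !mulmxBl !mulmxBr -(map_mxM _ A) AB0 map_mx0 subr0.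
rewrite mulmxDl -!(scalar_mxC 'X); apply/matrixP=> i j; rewrite !mxE.
ring.
Qed.

(** * Sums of powers of $q$ over the roots of a polynomial *)

Section Qsum.
Variable R : rcfType.
Implicit Types p : {poly R}.

(** Turns products into sums, so that identities between characteristic polynomials become
    identities between spectra. *)
Definition qsum p : qring R := \sum_(x <- rootsR p) qpow x *+ mup x p.

Lemma qpow0 : qpow 0 = 1 :> qring R.
Proof.
rewrite /qpow; have -> // : insubd (exponent0 R) 0 = exponent0 R.
by apply/val_inj; rewrite /= val_insubd; case: ifP.
Qed.

(** Non-roots have multiplicity 0; hence a product and its two factors can be summed over one common
    list. *)
Lemma qsumE p (s : seq R) :
    p != 0 -> uniq s -> (forall x, root p x -> x \in s) ->
  qsum p = \sum_(x <- s) qpow x *+ mup x p.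
Proof.
move=> p0 us ps; rewrite /qsum.
have rE x : root p x = (x \in rootsR p).
  by rewrite -(roots_on_rootsR p0) inE.
rewrite [RHS](bigID (mem (rootsR p))) /= [X in _ + X]big1 ?addr0; last first.
  by move=> x xp; rewrite mupNroot ?mulr0n // rE.
rewrite -[RHS]big_filter; apply: perm_big; apply: uniq_perm => [||x].
- exact: uniq_roots.
- exact: filter_uniq.
by rewrite mem_filter /= -rE andbC; case: (boolP (root p x)) => [/ps ->|];
  rewrite ?andbF.
Qed.

Lemma qsumM p1 p2 : p1 != 0 -> p2 != 0 -> qsum (p1 * p2) = qsum p1 + qsum p2.
Proof.
move=> p10 p20; have p0 : p1 * p2 != 0 by rewrite mulf_neq0.
pose s := rootsR (p1 * p2).
have rs x : root (p1 * p2) x -> x \in s by rewrite -(roots_on_rootsR p0) inE.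
rewrite !(@qsumE _ s) ?uniq_roots //.
- by rewrite -big_split; apply: eq_bigr => x _; rewrite mupM // mulrnDr.
- by move=> x px; apply: rs; rewrite rootM px orbT.
- by move=> x px; apply: rs; rewrite rootM px.
Qed.

Lemma qsumXn n : qsum 'X^n = n%:R.
Proof.
rewrite (@qsumE _ [:: 0]) ?monic_neq0 ?monicXn //.
  by rewrite big_seq1 -['X]subr0 -polyC0 mup_XsubCX eqxx qpow0.
by move=> x; rewrite rootE hornerXn expf_eq0 inE => /andP[].
Qed.

Lemma char_poly_neq0 n (A : 'M[R]_n) : char_poly A != 0.
Proof. exact/monic_neq0/char_poly_monic. Qed.

Lemma qsum_mulmxC m n (A : 'M[R]_(m, n)) (B : 'M[R]_(n, m)) :
  qsum (char_poly (A *m B)) + n%:R = qsum (char_poly (B *m A)) + m%:R.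
Proof.
have /(congr1 qsum) := char_poly_mulmxC A B.
by rewrite !qsumM ?char_poly_neq0 ?expf_neq0 ?polyX_eq0 // !qsumXn.
Qed.

Lemma qsum_spectrum d (E : finOrderType d) (Phi : {set {set E}}) (k : int) :
  \sum_(x <- spectrum R Phi k) qpow x = qsum (char_poly (laplacian R Phi k)).
Proof.
rewrite /spectrum big_flatten big_map /=; apply: eq_bigr => x _.
by rewrite big_nseq iter_addr addr0.
Qed.
End Qsum.

(** * Deletion, contraction and reduction: interval property and face counts *)

Section Minors.
Variable E : finType.
Implicit Types (Phi : {set {set E}}) (e : E) (F G H : {set E}).

Lemma setD1_id F e : e \notin F -> F :\ e = F.
Proof. by move=> eF; apply/setDidPl; rewrite disjoint_sym disjoints1. Qed.

Lemma setU1_id F e : e \in F -> e |: F = F.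
Proof. by move=> eF; apply/setUidPr; rewrite sub1set. Qed.

Lemma dimU1 F e : e \notin F -> dim (e |: F) = dim F + 1.
Proof. by move=> eF; rewrite /dim cardsU1 eF; lia. Qed.

Lemma dimD1 F v : v \in F -> dim (F :\ v) = dim F - 1.
Proof. by move=> vF; rewrite /dim (cardsD1 v F) vF; lia. Qed.

Lemma dim_geN1 F : -1 <= dim F.
Proof. by rewrite /dim; lia. Qed.

Lemma dim_ltE F : dim F < #|E|%:Z.
Proof. by rewrite /dim; move: (max_card F); lia. Qed.

Lemma in_contraction Phi e G :
  (G \in contraction Phi e) = (e \notin G) && (e |: G \in Phi).
Proof.
apply/imsetP/andP=> [[F + ->]|[eG GP]].
  by rewrite inE => /andP[FP eF]; rewrite setD1K // !inE eqxx.
by exists (e |: G); rewrite ?setU1K // inE GP setU11.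
Qed.

Lemma in_star Phi e F :
  (F \in star Phi e) = (F :\ e \in Phi) && (e |: F \in Phi).
Proof.
apply/bigcupP/andP=> [[G /and3P[eG GP GeP]]|[FP FeP]].
  by rewrite !inE => /orP[] /eqP ->; rewrite ?setU1K ?setUA ?setUid // setD1_id.
have eFe : e |: F :\ e = e |: F.
  by apply/setP=> x; rewrite !inE; case: eqVneq.
exists (F :\ e); first by rewrite FP eFe FeP !inE eqxx.
rewrite !inE eFe; case: (boolP (e \in F)) => eF.
  by rewrite setU1_id // eqxx orbT.
by rewrite setD1_id // eqxx.
Qed.

Lemma in_reduction Phi e F : (F \in reduction Phi e) =
  (F \in Phi) && ~~ ((F :\ e \in Phi) && (e |: F \in Phi)).
Proof. by rewrite inE in_star andbC. Qed.

Lemma deletion_interval Phi e : is_interval Phi -> is_interval (deletion Phi e).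
Proof.
move=> iP F G H FG GH; rewrite !inE => /andP[FP _] /andP[HP eH].
by rewrite (iP F G H) //=; apply: contra eH; apply/subsetP.
Qed.

Lemma contraction_interval Phi e :
  is_interval Phi -> is_interval (contraction Phi e).
Proof.
move=> iP F G H FG GH; rewrite !in_contraction => /andP[_ FP] /andP[eH HP].
rewrite (contra (subsetP GH e)) //.
by apply: (iP (e |: F) (e |: G) (e |: H)) => //; apply: setUS.
Qed.

(** Suppose $G$ is in the star. If $e \in F$, then $H \setminus e$ lies between $G \setminus e$ and
    $H$, which puts $H$ in the star; otherwise $F \cup e$ lies between $F$ and $G \cup e$, which
    puts $F$ there. *)
Lemma reduction_interval Phi e :
  is_interval Phi -> is_interval (reduction Phi e).
Proof.
move=> iP F G H FG GH; rewrite !in_reduction => /andP[FP Fs] /andP[HP Hs].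
rewrite (iP F G H) //=; apply/negP=> /andP[GeP eGP].
case: (boolP (e \in F)) => eF.
  move/negP: Hs; apply; rewrite setU1_id ?HP ?andbT.
    by apply: (iP (G :\ e) _ H); rewrite ?setSD ?subD1set.
  exact/(subsetP GH)/(subsetP FG).
move/negP: Fs; apply; rewrite setD1_id ?FP //=.
by apply: (iP F _ (e |: G)); rewrite ?setUS ?subsetUr.
Qed.

Lemma skeleton_interval Phi i j :
  is_interval Phi -> is_interval (skeleton Phi i j).
Proof.
move=> iP F G H FG GH; rewrite !inE => /andP[FP dF] /andP[HP dH].
rewrite (iP F G H) //=; move: dF dH (subset_leq_card FG) (subset_leq_card GH).
by rewrite /dim; lia.
Qed.

(** The star is a disjoint union of pairs $\{F, F \cup e\}$; each pair is counted once, by its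
    member without $e$. *)
Definition star_base Phi e k : {set {set E}} :=
  [set F in faces Phi k | (e \notin F) && (e |: F \in Phi)].

Lemma card_faces_minors Phi e k :
  #|faces Phi k| =
    (#|faces (deletion Phi e) k| + #|faces (contraction Phi e) (k - 1)|)%N.
Proof.
rewrite -(cardsID [set F : {set E} | e \in F]) addnC; congr (_ + _)%N.
  by apply: eq_card => F; rewrite !inE; case: (e \in F); rewrite ?andbT ?andbF.
rewrite -[RHS](card_in_imset (f := fun G => e |: G)); last first.
  move=> F G; rewrite !inE !in_contraction.
  move=> /andP[/andP[eF _] _] /andP[/andP[eG _] _].
  by move/(congr1 (fun H => H :\ e)); rewrite !setU1K.
apply: eq_card => F; apply/idP/imsetP => [|[G + ->]].
  rewrite !inE => /andP[/andP[FP dF] eF].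
  exists (F :\ e); last by rewrite setD1K.
  by rewrite inE in_contraction setD1K // FP !inE eqxx dimD1 //= (eqP dF).
rewrite !inE !in_contraction eqxx /= => /andP[/andP[eG ->] dG].
by rewrite dimU1 // (eqP dG); lia.
Qed.

(** A $k$-face of the star is either the lower member of its pair, or the upper one over a base of
    dimension $k - 1$. *)
Lemma card_faces_reduction Phi e k :
  #|faces Phi k| = (#|faces (reduction Phi e) k|
    + #|star_base Phi e k| + #|star_base Phi e (k - 1)|)%N.
Proof.
rewrite -(cardsID (star Phi e) (faces Phi k)) addnC -addnA; congr (_ + _)%N.
  apply: eq_card => F; rewrite inE [F \in faces (reduction _ _) _]inE.
  by rewrite [F \in reduction _ _]inE [in LHS]inE andbA.
rewrite -(cardsID [set F : {set E} | e \in F]) addnC; congr (_ + _)%N.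
  apply: eq_card => F; rewrite !inE in_star.
  case: (boolP (e \in F)) => eF; rewrite /= ?andbF //.
  rewrite setD1_id //.
  by case: (F \in Phi); rewrite //= ?andbF.
rewrite -[RHS](card_in_imset (f := fun G => e |: G)); last first.
  move=> F G; rewrite !inE => /andP[_ /andP[eF _]] /andP[_ /andP[eG _]].
  by move/(congr1 (fun H => H :\ e)); rewrite !setU1K.
apply: eq_card => F; apply/idP/imsetP => [|[G + ->]].
  rewrite !inE in_star => /andP[/andP[/andP[FP dF] /andP[FeP _]] eF].
  exists (F :\ e); last by rewrite setD1K.
  by rewrite !inE setD1K // FP FeP eqxx dimD1 //= (eqP dF) eqxx.
rewrite !inE in_star eqxx /= => /andP[/andP[GP dG] /andP[eG eGP]].
rewrite setU1K // GP setUA setUid eGP /= andbT dimU1 // (eqP dG); lia.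
Qed.
End Minors.

(** * The boundary operator and the splitting of the Laplacian spectrum *)

Lemma sum_enum_val_eq (R : pzRingType) (T : finType) (A : {set T}) x
    (g : T -> R) :
  \sum_(a < #|A|) (x == enum_val a)%:R * g (enum_val a) = g x *+ (x \in A).
Proof.
rewrite -(big_enum_val (A := mem A) (fun a => (x == a)%:R * g a)) big_mkcond /=.
rewrite (bigD1 x) //= eqxx mul1r big1 => [|y /negPf yx]; last first.
  by rewrite eq_sym yx mul0r; case: ifP.
by rewrite addr0; case: (x \in A).
Qed.

Lemma sum_enum_rank (R : nmodType) (T : finType) (g : T -> R) :
  \sum_(x < #|T|) g (enum_val x) = \sum_(x : T) g x.
Proof. by rewrite -(big_enum_val (A := T) g); apply: eq_bigl. Qed.

Section Chains.
Variables (R : rcfType) (d : Order.disp_t) (E : finOrderType d).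
Implicit Types (Phi : {set {set E}}) (F G H : {set E}).

Definition face_sign (v : E) F : R := (-1) ^+ #|[set w in F | (w < v)%O]|.

(** Deleting the smaller vertex [v] lowers the position of [w] by one, while deleting [w] leaves the
    position of [v] unchanged. *)
Lemma face_sign_swap F (v w : E) : v \in F -> w \in F -> (v < w)%O ->
  face_sign v F * face_sign w (F :\ v)
    = - (face_sign w F * face_sign v (F :\ w)).
Proof.
move=> vF wF vw; rewrite /face_sign [in RHS](cardsD1 v) !inE vF vw exprS.
rewrite mulN1r mulNr opprK mulrC; congr ((-1) ^+ _ * (-1) ^+ _).
  by apply: eq_card => u; rewrite !inE andbA.
apply: eq_card => u; rewrite !inE; case: eqVneq => //= ->.
by rewrite wF /= ltNge (ltW vw).
Qed.

Lemma incidence_facet F G :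
  incidence R F G = 0 \/ exists2 v, v \in F & G = F :\ v.
Proof.
case: (boolP [exists v in F, G == F :\ v]) => [/exists_inP[v vF /eqP]|FG].
  by right; exists v.
left; rewrite /incidence big_pred0 // => v; apply: contraNF FG => /andP[vF].
by rewrite eq_sym => FvG; apply/exists_inP; exists v.
Qed.

(** This is $\partial\partial = 0$ in the full simplex: removing two vertices in the two orders
    gives opposite signs, so the double sum is its own negative. *)
Lemma sum_incidence_incidence F G :
  \sum_(v in F) face_sign v F * incidence R (F :\ v) G = 0.
Proof.
pose c v w : R := (face_sign v F * face_sign w (F :\ v))
  *+ [&& v \in F, w \in F :\ v & F :\ v :\ w == G].
have cN v w : c v w = - c w v.
  rewrite /c !inE.
  have -> : F :\ w :\ v = F :\ v :\ w by rewrite setDDl setUC -setDDl.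
  case: (ltgtP v w) => [vw|wv|-> /=]; last by rewrite andbF mulr0n oppr0.
    case: (boolP (v \in F)) => vF; case: (boolP (w \in F)) => wF /=;
      rewrite ?mulr0n ?oppr0 //.
    by rewrite face_sign_swap // mulNrn.
  case: (boolP (v \in F)) => vF; case: (boolP (w \in F)) => wF /=;
    rewrite ?mulr0n ?oppr0 //.
  by rewrite [in RHS]face_sign_swap // mulNrn opprK.
have -> : \sum_(v in F) face_sign v F * incidence R (F :\ v) G
    = \sum_v \sum_w c v w.
  rewrite big_mkcond; apply: eq_bigr => v _; rewrite /c.
  case: (boolP (v \in F)) => vF /=; last by rewrite big1.
  rewrite /incidence big_mkcond big_distrr; apply: eq_bigr => w _ /=.
  by case: ifP; rewrite ?mulr0.
set S := \sum_v _; have: S = - S.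
  rewrite /S [LHS]exchange_big /= -sumrN; apply: eq_bigr => v _.
  by rewrite -sumrN; apply: eq_bigr => w _.
by move/eqP; rewrite -addr_eq0 -mulr2n mulrn_eq0 /= => /eqP.
Qed.

(* The boundary of C_k, written on the whole of {set E}: subfamilies of faces
   then give matrices of the same size, which can be compared by [=]. *)
Definition boundary_pad Phi (k : int) : 'M[R]_#|{set E}| :=
  \matrix_(b, a) (incidence R (enum_val a) (enum_val b)
    *+ [&& dim (enum_val a) == k, enum_val a \in Phi & enum_val b \in Phi]).

(** The isometric inclusion of $C_k$ into the space spanned by all subsets. *)
Definition faces_mx Phi (k : int) : 'M[R]_(#|{set E}|, #|faces Phi k|) :=
  \matrix_(x, a) (enum_val x == enum_val a)%:R.

Lemma faces_mxK Phi k : (faces_mx Phi k)^T *m faces_mx Phi k = 1%:M.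
Proof.
apply/matrixP=> a b; rewrite !mxE.
pose g F : R := (enum_val a == F)%:R * (F == enum_val b)%:R.
transitivity (\sum_(x < #|{set E}|) g (enum_val x)).
  by apply: eq_bigr => x _; rewrite !mxE eq_sym.
rewrite sum_enum_rank /g (bigD1 (enum_val a)) //= eqxx mul1r big1 ?addr0.
  by rewrite (inj_eq enum_val_inj).
by move=> F /negPf Fa; rewrite eq_sym Fa mul0r.
Qed.

Lemma boundary_padE Phi (k l : int) : l = k - 1 ->
  faces_mx Phi l *m boundary R Phi k l *m (faces_mx Phi k)^T
    = boundary_pad Phi k.
Proof.
move=> kl; apply/matrixP=> x y; rewrite !mxE.
pose g F := incidence R F (enum_val x) *+ (enum_val x \in faces Phi l).
transitivity (\sum_(a < #|faces Phi k|)
    (enum_val y == enum_val a)%:R * g (enum_val a)).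
  apply: eq_bigr => a _; rewrite !mxE mulrC; congr (_ * _).
  rewrite /g -sum_enum_val_eq; by apply: eq_bigr => b _; rewrite !mxE.
rewrite sum_enum_val_eq /g -mulrnA mulnb /faces !inE.
have [->|[v vy ->]] := incidence_facet (enum_val y) (enum_val x).
  by rewrite !mul0rn.
rewrite dimD1 // kl (inj_eq (addIr _)).
by case: (enum_val y \in Phi); case: (_ :\ v \in Phi); case: (dim _ == k).
Qed.

(** Every set between two faces of an interval is a face, so no term of $\partial\partial$ in the
    full simplex is lost. *)
Lemma boundary_pad_mul0 Phi k : is_interval Phi ->
  boundary_pad Phi k *m boundary_pad Phi (k + 1) = 0.
Proof.
move=> iP; apply/matrixP=> x y; rewrite !mxE.
set G := enum_val x; set F := enum_val y.
pose g H := incidence R H G *+ [&& dim H == k, H \in Phi & G \in Phi] *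
  (incidence R F H *+ [&& dim F == k + 1, F \in Phi & H \in Phi]).
transitivity (\sum_(z < #|{set E}|) g (enum_val z)).
  by apply: eq_bigr => z _; rewrite !mxE.
rewrite sum_enum_rank /g.
case: (boolP [&& dim F == k + 1, F \in Phi & G \in Phi]) =>
    [/and3P[/eqP dF FP GP]|no]; last first.
  apply: big1 => H _.
  case: (boolP (H \in Phi)) => HP; rewrite ?andbF ?mulr0n ?mulr0 //.
  rewrite !andbT; case: (boolP (G \in Phi)) no => GP;
    rewrite /= ?andbT ?andbF ?mulr0n ?mul0r //.
  by move/negPf->; rewrite mulr0.
rewrite -[RHS](sum_incidence_incidence F G).
transitivity
    (\sum_H \sum_(v in F | F :\ v == H) face_sign v F * incidence R H G);
  last first.
  rewrite [RHS](partition_big (fun v => F :\ v) predT) //=.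
  apply: eq_bigr => H _.
  by apply: eq_bigr => v /andP[_ /eqP ->].
apply: eq_bigr => H _.
rewrite -big_distrl /= -[X in _ = X * _]/(incidence R F H) mulrC.
have [->|[v vF HE]] := incidence_facet F H; first by rewrite mul0rn !mul0r.
have [->|[w wH GE]] := incidence_facet H G; first by rewrite mul0rn !mulr0.
have HP : H \in Phi.
  by apply: (iP G H F) => //; rewrite ?GE ?HE subD1set.
by rewrite dF FP HP GP HE dimD1 // dF addrK !eqxx /= !mulr1n.
Qed.

(** This is $N_k$: subtracting the size of the matrix replaces each $q^x$ by $q^x - 1$, so the zero
    eigenvalues created by padding do not count. *)
Definition boundary_qsum Phi k : qring R :=
  qsum (char_poly (boundary_pad Phi k *m (boundary_pad Phi k)^T))
    - #|{set E}|%:R.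

Lemma spectrum_boundary_qsum Phi k : is_interval Phi ->
  \sum_(x <- spectrum R Phi k) qpow x =
    #|faces Phi k|%:R + boundary_qsum Phi k + boundary_qsum Phi (k + 1).
Proof.
move=> iP; rewrite qsum_spectrum /boundary_qsum.
set D := boundary_pad Phi k; set D1 := boundary_pad Phi (k + 1).
set J := faces_mx Phi k; set L := laplacian R Phi k.
(* The padded sum is the Laplacian carried over by the inclusion [J]. *)
have LE : D1 *m D1^T + D^T *m D = J *m (L *m J^T).
  rewrite /D1 -(@boundary_padE Phi (k + 1) k) ?addrK //.
  rewrite /D -(@boundary_padE Phi k (k - 1)) //.
  rewrite !trmx_mul !trmxK -/J /L /laplacian mulmxDl mulmxDr !mulmxA.
  congr (_ + _).
    by rewrite -(mulmxA _ (faces_mx _ _)^T) faces_mxK mulmx1.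
  by rewrite -(mulmxA _ (faces_mx _ _)^T) faces_mxK mulmx1.
(* This makes the characteristic polynomial of the sum factor, up to powers of $X$. *)
have DD0 : D1 *m D1^T *m (D^T *m D) = 0.
  have D0 : D *m D1 = 0 by exact: boundary_pad_mul0.
  by rewrite mulmxA -(mulmxA D1) -trmx_mul D0 trmx0 mulmx0 mul0mx.
have /(congr1 (@qsum R)) := char_polyD_mul0 DD0.
rewrite !qsumM ?char_poly_neq0 ?expf_neq0 ?polyX_eq0 // qsumXn LE => E1.
(* As [J^T *m J] is the identity, passing from $J L J^T$ back to $L$ only changes the number of zero
   eigenvalues. *)
have := qsum_mulmxC J (L *m J^T); rewrite -mulmxA faces_mxK mulmx1 => E2.
have := qsum_mulmxC D^T D => /addIr E3; rewrite E3 in E1.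
move: E1 E2.
move: (qsum (char_poly (J *m _))) (qsum (char_poly L)) => a b.
move: (qsum _) (qsum _) => x y; move: (_%:R) (_%:R) => f n E1 E2.
apply: (addIr (f + n)).
have -> : b = a + f - n by rewrite E2 addrK.
have -> : a = y + x - n by rewrite -E1 addrK.
ring.
Qed.
End Chains.

(** * Defects of the recursion and their behaviour on skeleta *)

Section Recursion.
Variables (R : rcfType) (d : Order.disp_t) (E : finOrderType d).
Implicit Types (Phi Psi : {set {set E}}) (e : E).

(** The padded boundary can be nonzero only at pairs $F$, $F \setminus v$ of faces with $\dim F =
    k$, so these pairs determine it. *)
Lemma eq_boundary_qsum Phi Psi k :
    (forall (F : {set E}) v, v \in F -> dim F = k ->
      (F \in Phi) && (F :\ v \in Phi) = (F \in Psi) && (F :\ v \in Psi)) ->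
  boundary_qsum R Phi k = boundary_qsum R Psi k.
Proof.
move=> PP; rewrite /boundary_qsum.
suff -> : boundary_pad R Phi k = boundary_pad R Psi k by [].
apply/matrixP=> x y; rewrite !mxE.
have [->|[v vy ->]] := incidence_facet R (enum_val y) (enum_val x).
  by rewrite !mul0rn.
congr (_ *+ nat_of_bool _).
by case: eqP => //= dk; rewrite PP.
Qed.

Lemma boundary_qsum0 Phi k :
    (forall (F : {set E}) v, v \in F -> dim F = k ->
      F \in Phi -> F :\ v \notin Phi) ->
  boundary_qsum R Phi k = 0.
Proof.
move=> P0; rewrite (@eq_boundary_qsum _ set0) /boundary_qsum => [|F v vF dF].
  have -> : boundary_pad R set0 k = 0 :> 'M_#|{set E}|.
    by apply/matrixP=> x y; rewrite !mxE !in_set0 /= andbF.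
  rewrite mul0mx /char_poly /char_poly_mx map_mx0 subr0 det_scalar qsumXn.
  by rewrite subrr.
by rewrite !inE; apply/negP=> /andP[/(P0 _ _ vF dF)/negP].
Qed.

(* The failure of the recursion at t^(k + 1) is the sum of the defects at k and
   k + 1; a k-face of the star is counted in the latter if it avoids e, and in
   the former otherwise. *)
Definition spectral_defect Phi e k : qring R :=
  boundary_qsum R Phi k - qpow 1 * boundary_qsum R (deletion Phi e) k
  - qpow 1 * boundary_qsum R (contraction Phi e) (k - 1)
  - (1 - qpow 1) * (boundary_qsum R (reduction Phi e) k
                    - #|star_base Phi e (k - 1)|%:R).

Lemma spectrum_no_faces Phi k : faces Phi k = set0 ->
  \sum_(x <- spectrum R Phi k) qpow x = 0 :> qring R.
Proof.
move=> P0; rewrite qsum_spectrum; move: (laplacian R Phi k).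
by rewrite P0 cards0 => L; rewrite /char_poly det_mx00 -(expr0 'X) qsumXn.
Qed.

Lemma coef_spectrum_poly Phi n :
  (spectrum_poly R Phi)`_n = \sum_(x <- spectrum R Phi (n%:Z - 1)) qpow x.
Proof.
rewrite /spectrum_poly coef_sum.
under eq_bigr => i _ do rewrite mulrC coefCM coefXn.
case: (ltnP n #|E|.+1) => nE.
  rewrite (bigD1 (Ordinal nE)) //= eqxx mulr1 [X in _ + X]big1 ?addr0 //.
  move=> i /negPf ni.
  by rewrite eq_sym -val_eqE /= in ni *; rewrite ni mulr0.
rewrite big1 ?spectrum_no_faces //.
  apply/setP=> F; rewrite !inE; apply/negP=> /andP[_ /eqP dF].
  by have := dim_ltE F : dim F < #|E|%:Z; rewrite dF; lia.
by move=> i _; rewrite gtn_eqF ?mulr0 // (leq_trans (ltn_ord i)).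
Qed.

Lemma coefCXCM (A : comNzRingType) (x y : A) (a b c : {poly A}) n :
  (x%:P * a + x%:P * 'X * b + y%:P * c)`_n =
    x * a`_n + x * (if n == 0%N then 0 else b`_n.-1) + y * c`_n.
Proof. by rewrite !coefD -mulrA !coefCM coefXM. Qed.

(** The recursion at $t^n$ says $X_{n-1} + X_n = 0$; starting from $X_{-1} = 0$, induction kills
    every $X_k$. *)
Lemma recursion_telescope (p a b c : {poly qring R})
    (Sp Sa Sb Sc X : int -> qring R) :
    (forall n, p`_n = Sp (n%:Z - 1)) -> (forall n, a`_n = Sa (n%:Z - 1)) ->
    (forall n, b`_n = Sb (n%:Z - 1)) -> (forall n, c`_n = Sc (n%:Z - 1)) ->
    Sb (- 2) = 0 -> (forall k, k <= -1 -> X k = 0) ->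
    (forall k, Sp k - qpow 1 * Sa k - qpow 1 * Sb (k - 1) - (1 - qpow 1) * Sc k
      = X k + X (k + 1)) ->
  p = q * a + q * t * b + (1 - q) * c <-> forall k, X k = 0.
Proof.
move=> pS aS bS cS Sb0 Xlow SX.
have coefE n : (q * a + q * t * b + (1 - q) * c)`_n = qpow 1 * Sa (n%:Z - 1)
    + qpow 1 * Sb (n%:Z - 1 - 1) + (1 - qpow 1) * Sc (n%:Z - 1).
  have -> : 1 - q = (1 - qpow 1)%:P :> {poly qring R} by rewrite polyCB polyC1.
  (* At $n = 0$ the factor $t$ leaves no coefficient of [b], in agreement with the vanishing of [Sb]
     at $-2$. *)
  have <- : (if n == 0%N then 0 else b`_n.-1) = Sb (n%:Z - 1 - 1).
    by case: n => [|n] /=; rewrite ?Sb0 // bS; congr (Sb _); lia.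
  by rewrite -aS -cS; exact: coefCXCM.
split=> [rec k|X0].
  have step n : X (n%:Z - 1) = 0.
    elim: n => [|n IH]; first exact: Xlow.
    have := SX (n%:Z - 1); rewrite IH add0r.
    have -> : n%:Z - 1 + 1 = n.+1%:Z - 1 by lia.
    by move=> <-; rewrite -pS rec coefE; ring.
  case: (lerP k (-1)) => k1; first exact: Xlow.
  have -> : k = (absz (k + 1))%:Z - 1 by lia.
  exact: step.
apply/polyP=> n; rewrite coefE pS; apply/eqP; rewrite -subr_eq0; apply/eqP.
by have := SX (n%:Z - 1); rewrite !X0 addr0 => <-; ring.
Qed.

Lemma spectral_recursionP Phi e : is_interval Phi ->
  satisfies_spectral_recursion R Phi e <->
  forall k, spectral_defect Phi e k = 0.
Proof.
move=> iP; pose S Psi k : qring R := \sum_(x <- spectrum R Psi k) qpow x.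
apply: (@recursion_telescope _ _ _ _ (S Phi) (S (deletion Phi e))
  (S (contraction Phi e)) (S (reduction Phi e))); rewrite {}/S;
  try exact: coef_spectrum_poly.
- apply: spectrum_no_faces; apply/setP=> F; rewrite !inE.
  by apply/negP=> /andP[_]; move: (dim_geN1 F); lia.
- move=> k k1; rewrite /spectral_defect.
  have b0 Psi l : l <= -1 -> boundary_qsum R Psi l = 0.
    move=> l1; apply: boundary_qsum0 => F v vF dF.
    by move: (dim_geN1 (F :\ v)); rewrite dimD1 // dF; lia.
  have -> : star_base Phi e (k - 1) = set0.
    apply/setP=> F; rewrite !inE; apply/negP=> /andP[/andP[_ dF] _].
    by move: (dim_geN1 F); lia.
  by rewrite !b0 ?cards0; [ring|lia..].
move=> k.
rewrite (spectrum_boundary_qsum _ k iP).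
rewrite (spectrum_boundary_qsum _ k (deletion_interval iP)).
rewrite (spectrum_boundary_qsum _ (k - 1) (contraction_interval iP)).
rewrite (spectrum_boundary_qsum _ k (reduction_interval iP)).
rewrite /spectral_defect (addrK (1 : int) k) (subrK (1 : int) k).
(* Once the face counts of the minors are eliminated, what they leave is $1 - q$ times the two
   star-base counts, one for each defect. *)
have -> : #|faces (deletion Phi e) k|%:R =
    #|faces Phi k|%:R - #|faces (contraction Phi e) (k - 1)|%:R :> qring R.
  by rewrite (card_faces_minors Phi e) natrD addrK.
have -> : #|faces (reduction Phi e) k|%:R = #|faces Phi k|%:R
    - #|star_base Phi e k|%:R - #|star_base Phi e (k - 1)|%:R :> qring R.
  by rewrite (card_faces_reduction Phi e) !natrD addrAC !addrK.
move: (_%:R) (_%:R) (_%:R) (_%:R) (qpow 1) => f fc b b1 x.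
do 8 move: (boundary_qsum _ _ _) => ?.
ring.
Qed.

(** The condition $i < k \le j$ says that both $k - 1$ and $k$ lie in $[i, j]$, so that pairs $F$,
    $F \setminus v$ with $\dim F = k$ survive. *)
Lemma spectral_defect_skeleton Phi e i j k : is_interval Phi ->
  spectral_defect (skeleton Phi i j) e k =
    if i < k <= j then spectral_defect Phi e k else 0.
Proof.
move=> iP; case: ifPn => kij; rewrite /spectral_defect.
  have -> : boundary_qsum R (skeleton Phi i j) k = boundary_qsum R Phi k.
    apply: eq_boundary_qsum => F v vF dF; rewrite !inE dimD1 // dF.
    have -> : i <= k <= j by lia.
    have -> : i <= k - 1 <= j by lia.
    by rewrite !andbT.
  have -> : boundary_qsum R (deletion (skeleton Phi i j) e) k
      = boundary_qsum R (deletion Phi e) k.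
    apply: eq_boundary_qsum => F v vF dF; rewrite !inE dimD1 // dF.
    have -> : i <= k <= j by lia.
    have -> : i <= k - 1 <= j by lia.
    by rewrite !andbT.
  have -> : boundary_qsum R (contraction (skeleton Phi i j) e) (k - 1)
      = boundary_qsum R (contraction Phi e) (k - 1).
    apply: eq_boundary_qsum => F v vF dF; rewrite !in_contraction.
    case: (boolP (e \in F)) => //= eF; case: (boolP (e \in F :\ v)) => //= eFv.
      by rewrite !andbF.
    rewrite !inE !dimU1 // dimD1 // dF.
    have -> : i <= k - 1 + 1 <= j by lia.
    have -> : i <= k - 1 - 1 + 1 <= j by lia.
    by rewrite !andbT.
  (* A face lost from the star in the skeleton is incident only to faces that
     stay in the star. *)
  have -> : boundary_qsum R (reduction (skeleton Phi i j) e) k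
      = boundary_qsum R (reduction Phi e) k.
    apply: eq_boundary_qsum => F v vF dF; rewrite !in_reduction.
    have skE H : dim H = k \/ dim H = k - 1 ->
        (H \in skeleton Phi i j) = (H \in Phi).
      move=> dH; rewrite inE; have -> : i <= dim H <= j by lia.
      by rewrite andbT.
    have sk1 H : H \in skeleton Phi i j -> H \in Phi by rewrite inE => /andP[].
    have dG := dimD1 vF; rewrite dF in dG.
    rewrite (skE F) ?(skE (F :\ v)); [|by right|by left].
    case: (boolP (F \in Phi)) => //= FP.
    case: (boolP (F :\ v \in Phi)) => GP; rewrite ?andbF //=.
    (* The only set tested for the star that may leave the window is $F \setminus v \setminus e$, of
       dimension $k - 2$, if $e \in F$, and $F \cup e$, of dimension $k + 1$, if not. Where it could
       matter, the interval property shows that it is not a face of [Phi]. *)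
    case: (boolP (e \in F)) => eF.
      rewrite (setU1_id eF) (skE F) ?FP ?andbT ?(skE (F :\ e));
        [|by right; rewrite dimD1 ?dF|by left].
      case: (boolP (F :\ e \in Phi)) => //= FeP.
      have GeP : F :\ v :\ e \notin Phi.
        apply: contra FeP => GeP; apply: (iP (F :\ v :\ e) _ F) => //;
          by rewrite ?setSD ?subD1set.
      by rewrite (negPf GeP) (contraNF (sk1 _)).
    have eG : e \notin F :\ v by rewrite !inE (negPf eF) andbF.
    rewrite (setD1_id eG) GP (setD1_id eF) FP !(skE F) ?(skE (F :\ v)) ?FP ?GP;
      [|by right|by left].
    rewrite (skE (e |: F :\ v)) /=; last by left; rewrite dimU1 // dG subrK.
    case: (boolP (e |: F :\ v \in Phi)) => eGP; rewrite ?andbF ?andbT //=.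
    have eFP : e |: F \notin Phi.
      apply: contra eGP => eFP; apply: (iP (F :\ v) _ (e |: F)) => //;
        by rewrite ?subsetUr ?setUS ?subD1set.
    by rewrite (negPf eFP) (contraNF (sk1 _)).
  have -> // : star_base (skeleton Phi i j) e (k - 1) = star_base Phi e (k - 1).
  apply/setP=> F; rewrite !inE.
  case: (boolP (e \in F)) => eF; rewrite /= ?andbF // dimU1 //.
  case: (F \in Phi) => //=; case: (_ |: _ \in _); rewrite ?andbF //=; lia.
(* Outside the range, $k$ and $k - 1$ are not both in $[i, j]$, so no face of dimension $k$ keeps a
   facet. *)
have b0 Psi : (forall F, F \in Psi -> i <= dim F <= j) ->
    boundary_qsum R Psi k = 0.
  move=> dP; apply: boundary_qsum0 => F v vF dF FP; apply/negP=> /dP.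
  by rewrite dimD1 // dF; move: (dP F FP) kij; rewrite dF; lia.
(* Adding $e$ back raises dimensions by one, so the same window argument applies at $k - 1$. *)
have -> : boundary_qsum R (contraction (skeleton Phi i j) e) (k - 1) = 0.
  apply: boundary_qsum0 => F v vF dF; rewrite !in_contraction => /andP[eF].
  rewrite inE dimU1 // dF => /andP[_ kj]; apply/negP=> /andP[eFv].
  rewrite inE dimU1 // dimD1 // dF => /andP[_ ki].
  by move: kij ki kj; lia.
have -> : star_base (skeleton Phi i j) e (k - 1) = set0.
  apply/setP=> F; rewrite !inE.
  apply/negP=> /andP[/andP[/andP[_ dF1] dF] /andP[eF]].
  by rewrite dimU1 //; move: kij dF1 dF; lia.
rewrite cards0 !b0.
- ring.
- by move=> F; rewrite in_reduction inE => /andP[/andP[]].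
- by move=> F; rewrite !inE => /andP[/andP[]].
- by move=> F; rewrite !inE => /andP[].
Qed.
End Recursion.

Theorem theorem4p7 (R : realType) (d : Order.disp_t) (E : finOrderType d)
    (Phi : {set {set E}}) (e : E) :
  is_interval Phi ->
  satisfies_spectral_recursion R Phi e ->
  forall i j : int, satisfies_spectral_recursion R (skeleton Phi i j) e.
Proof.
move=> iP /(spectral_recursionP _ _ iP) X0 i j.
apply/spectral_recursionP; first exact: skeleton_interval.
by move=> k; rewrite spectral_defect_skeleton // X0 if_same.
Qed.
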